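(* Let $E$ and $F$ be archimedean Riesz spaces. Then every positive $\mathbb{Q}$-polynomial $P\colon E\to F$ is a polynomial.
   Context: Riesz spaces (vector lattices) are over the real numbers. Let $E,F$ be real vector spaces. For $k\ge 1$, a mapping $P_k\colon E\to F$ is a $k$-homogeneous polynomial (respectively, a $k$-homogeneous $\mathbb{Q}$-polynomial) if there is a mapping $A_k\colon E^k\to F$ that is $\mathbb{R}$-linear (respectively, merely additive) in each of its $k$ variables such that $P_k(x)=A_k(x,\dots,x)$ for all $x\in E$. For $k=0$ both notions mean a constant mapping, identified with its value $A_0\in F$. The mapping $A_k$ may always be chosen symmetric, and the symmetric choice is uniquely determined by $P_k$. A mapping $P\colon E\to F$ is a polynomial of degree $m$ (respectively, a $\mathbb{Q}$-polynomial of degree $m$) if $P=P_0+\dots+P_m$ with each $P_k$ a $k$-homogeneous polynomial (respectively, $k$-homogeneous $\mathbb{Q}$-polynomial) and $P_m\ne 0$; the zero mapping is also regarded as a polynomial and as a $\mathbb{Q}$-polynomial. The homogeneous components $P_k$ are uniquely determined by $P$. When $E,F$ are Riesz spaces, a $k$-homogeneous $\mathbb{Q}$-polynomial $P_k$ with generating symmetric $k$-additive mapping $A_k$ is positive if $A_k(x_1,\dots,x_k)\ge 0$ for all $x_1,\dots,x_k\ge 0$ in $E$ (for $k=0$: the constant is $\ge 0$). A $\mathbb{Q}$-polynomial $P=P_0+\dots+P_m$ is positive if each homogeneous component $P_k$ is positive. *)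

(* Defs.v *)
From HB Require Import structures.
From mathcomp Require Import all_boot all_order all_algebra all_fingroup.
From mathcomp Require Import reals.

Set Implicit Arguments.
Unset Strict Implicit.
Unset Printing Implicit Defensive.

Import Order.TTheory GRing.Theory Num.Theory.

Local Open Scope ring_scope.

(* The order is boolean and the carrier is a choiceType, as everywhere in
   MathComp: classically, every Riesz space carries such a structure.  The
   lattice operations are axiomatized as in Order.Lattice, which is not itself
   inherited because Num.RealDomain already joins it with Zmodule and the
   hierarchy can only be extended upwards. *)
HB.mixin Record POrderedLmodule_isRiesz (R : realType) E
    of GRing.Lmodule R E & Num.POrderedZmodule E := {
  riesz_leD2r : forall z x y : E, x <= y -> x + z <= y + z;
  riesz_scaler_ge0 : forall (a : R) (x : E), 0 <= a -> 0 <= x -> 0 <= a *: x;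
  riesz_meet : E -> E -> E;
  riesz_join : E -> E -> E;
  riesz_lexI : forall x y z : E,
    (x <= riesz_meet y z) = (x <= y) && (x <= z);
  riesz_leUx : forall x y z : E,
    (riesz_join x y <= z) = (x <= z) && (y <= z)
}.

#[short(type="rieszType")]
HB.structure Definition Riesz (R : realType) :=
  { E of GRing.Lmodule R E & Num.POrderedZmodule E
       & POrderedLmodule_isRiesz R E }.

Definition riesz_archimedean (R : realType) (E : rieszType R) : Prop :=
  forall x y : E, 0 <= x -> (forall n : nat, x *+ n <= y) -> x = 0.

Section MultiMaps.
Variables (R : realType) (E F : lmodType R) (k : nat).
Implicit Types (x : {ffun 'I_k -> E}) (A : {ffun 'I_k -> E} -> F).

Definition subst_var x (i : 'I_k) (u : E) : {ffun 'I_k -> E} :=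
  [ffun j => if j == i then u else x j].

Definition multiadditive A : Prop :=
  forall x i u v,
    A (subst_var x i (u + v)) = A (subst_var x i u) + A (subst_var x i v).

Definition multilinear A : Prop :=
  forall x i, linear (fun u : E => A (subst_var x i u)).

Definition multi_symmetric A : Prop :=
  forall (s : 'S_k) x, A [ffun i => x (s i)] = A x.

(* For k = 0 the domain of A is a singleton, so A is an element of F and P is
   the corresponding constant mapping. *)
Definition generates A (P : E -> F) : Prop :=
  forall x : E, P x = A [ffun=> x].

Definition homogeneous_polynomial (P : E -> F) : Prop :=
  exists A, multilinear A /\ generates A P.

Definition homogeneous_Qpolynomial (P : E -> F) : Prop :=
  exists A, multiadditive A /\ generates A P.

End MultiMaps.

(* The symmetric generating mapping A exists and is unique, so that quantifying
   over it existentially is the same as referring to "the" symmetric A. *)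
Definition positive_homogeneous_Qpolynomial (R : realType) (E F : rieszType R)
    (k : nat) (P : E -> F) : Prop :=
  exists A : {ffun 'I_k -> E} -> F,
    [/\ multiadditive A, multi_symmetric A, generates A P
      & forall x : {ffun 'I_k -> E}, (forall i, 0 <= x i) -> 0 <= A x].

Section Polynomials.
Variables (R : realType) (E F : lmodType R).

(* P = P_0 + ... + P_m with each P_k in the class H k and P_m nonzero. *)
Definition sum_of_degree (H : nat -> (E -> F) -> Prop) (m : nat) (P : E -> F) :
    Prop :=
  exists Pc : 'I_m.+1 -> E -> F,
    [/\ forall k : 'I_m.+1, H k (Pc k),
        exists x : E, Pc ord_max x <> 0
      & forall x : E, P x = \sum_(k < m.+1) Pc k x].

Definition zero_or_sum (H : nat -> (E -> F) -> Prop) (P : E -> F) : Prop :=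
  (forall x : E, P x = 0) \/ exists m : nat, sum_of_degree H m P.

Definition is_polynomial : (E -> F) -> Prop :=
  zero_or_sum (@homogeneous_polynomial R E F).

Definition is_Qpolynomial : (E -> F) -> Prop :=
  zero_or_sum (@homogeneous_Qpolynomial R E F).

End Polynomials.

(* The homogeneous components are unique (all zero for the zero mapping), so
   one decomposition into positive components suffices; the lemma below checks
   that such a mapping is a Q-polynomial. *)
Definition positive_Qpolynomial (R : realType) (E F : rieszType R) :
    (E -> F) -> Prop :=
  zero_or_sum (@positive_homogeneous_Qpolynomial R E F).

Lemma positive_Qpolynomial_is_Qpolynomial (R : realType) (E F : rieszType R)
  (P : E -> F) : positive_Qpolynomial P -> is_Qpolynomial P.
Proof.
case=> [P0|[m [Pc [HPc nz PE]]]]; [by left | right; exists m, Pc; split=> // k].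
by have [A [A_add _ AE _]] := HPc k; exists A.
Qed.

(* Main.v *)
Require Import Defs.
From mathcomp Require Import all_boot all_order all_algebra.
From mathcomp Require Import reals.

(** A positive additive map g into an archimedean Riesz space is homogeneous:
    for u >= 0, a >= 0 and m <= n a < m + 1, both n g(a u) and n a g(u) lie
    between m g(u) and (m + 1) g(u), so n |g(a u) - a g(u)| <= g(u) for all n.
    Since every vector is a difference of two positive ones, this passes to
    each variable of a positive multiadditive map, first when the other
    variables are positive and then, by additivity in them, in general. *)

Set Implicit Arguments.
Unset Strict Implicit.
Unset Printing Implicit Defensive.

Import Order.TTheory GRing.Theory Num.Theory.

Local Open Scope ring_scope.

Section RieszOrder.
Variables (R : realType) (E : rieszType R).
Implicit Types x y u : E.

Lemma riesz_subr_ge0 x y : (0 <= y - x) = (x <= y).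
Proof.
by apply/idP/idP => [/(riesz_leD2r x)|/(riesz_leD2r (- x))];
   rewrite ?subrK ?add0r ?subrr.
Qed.

Lemma riesz_ler_wZ2r u (a b : R) : 0 <= u -> a <= b -> a *: u <= b *: u.
Proof.
by move=> u0 ab; rewrite -riesz_subr_ge0 -scalerBl riesz_scaler_ge0 ?subr_ge0.
Qed.

Lemma riesz_ler_wZ2l (a : R) x y : 0 <= a -> x <= y -> a *: x <= a *: y.
Proof.
by move=> a0 xy; rewrite -riesz_subr_ge0 -scalerBr riesz_scaler_ge0 ?riesz_subr_ge0.
Qed.

Lemma riesz_subr_le0 x y : (x - y <= 0) = (x <= y).
Proof. by rewrite -(riesz_subr_ge0 (x - y)) sub0r opprB riesz_subr_ge0. Qed.

Lemma riesz_lerB x y z t : x <= y -> z <= t -> x - t <= y - z.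
Proof.
move=> xy zt; apply: (@le_trans _ _ (y - t)); first exact: riesz_leD2r.
by rewrite -riesz_subr_ge0 addrC opprB addrA subrK riesz_subr_ge0.
Qed.

Lemma riesz_decomposition u : exists p q : E, [/\ 0 <= p, 0 <= q & u = p - q].
Proof.
have /andP[uj zj] : (u <= riesz_join u 0) && (0 <= riesz_join u 0).
  by rewrite -riesz_leUx.
(* The positive part of [u], and the negative part written as what the positive part exceeds [u]
   by. *)
exists (riesz_join u 0), (riesz_join u 0 - u).
by rewrite riesz_subr_ge0 opprB addrCA subrr addr0.
Qed.

(* The archimedean axiom only speaks of positive elements, hence the detour
   through the positive part of x. *)
Lemma riesz_archimedean_le0 x y : riesz_archimedean E ->
  0 <= y -> (forall n : nat, x *+ n <= y) -> x <= 0.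
Proof.
move=> archE y0 xy.
have /andP[xj zj] : (x <= riesz_join x 0) && (0 <= riesz_join x 0).
  by rewrite -riesz_leUx.
rewrite -[leRHS](archE (riesz_join x 0) y) // => -[|n]; first by rewrite mulr0n.
have n0 : 0 <= n.+1%:R^-1 :> R by rewrite invr_ge0 ler0n.
(* After division by [n.+1] it suffices to bound [x] and [0] separately, so no rule for multiples of
   a join is needed. *)
have : riesz_join x 0 <= n.+1%:R^-1 *: y.
  rewrite riesz_leUx riesz_scaler_ge0 // andbT.
  have := riesz_ler_wZ2l n0 (xy n.+1).
  by rewrite -scaler_nat scalerA mulVf ?pnatr_eq0 // scale1r.
move/(riesz_ler_wZ2l (ler0n R n.+1)).
by rewrite scalerA divff ?pnatr_eq0 // scale1r scaler_nat.
Qed.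

End RieszOrder.

Section PositiveAdditive.
Variables (R : realType) (E F : rieszType R) (g : E -> F).
Hypothesis archF : riesz_archimedean F.
Hypothesis gD : {morph g : u v / u + v}.
Hypothesis g_ge0 : forall u : E, 0 <= u -> 0 <= g u.

Let g0 : g 0 = 0.
Proof. by apply: (addrI (g 0)); rewrite -gD !addr0. Qed.

Let gN : {morph g : u / - u}.
Proof. by move=> u; apply: (addrI (g u)); rewrite -gD !subrr. Qed.

Let gMn n : {morph g : u / u *+ n}.
Proof. by move=> u; elim: n => [|n IHn]; rewrite ?mulr0n // !mulrS gD IHn. Qed.

Let g_le u v : u <= v -> g u <= g v.
Proof. by rewrite -riesz_subr_ge0 => /g_ge0; rewrite gD gN riesz_subr_ge0. Qed.

Let gZ_pos (a : R) u : 0 <= a -> 0 <= u -> g (a *: u) = a *: g u.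
Proof.
move=> a0 u0; have gu0 := g_ge0 u0.
have bounds n : exists m : nat,
    (g u *+ m <= g (a *: u) *+ n <= g u *+ m.+1) &&
    (g u *+ m <= (a *: g u) *+ n <= g u *+ m.+1).
  have na0 : 0 <= n%:R * a by rewrite mulr_ge0 ?ler0n.
  exists (Num.truncn (n%:R * a)).
  have /andP[lo /ltW hi] := truncn_itv na0.
  (* Stated for any Riesz space: it serves in [F] at [g u], and in [E] at [u], from where
     monotonicity of [g] carries it to [F]. *)
  have sandwich (G : rieszType R) (w : G) : 0 <= w ->
      (w *+ Num.truncn (n%:R * a) <= (a *: w) *+ n)
      && ((a *: w) *+ n <= w *+ (Num.truncn (n%:R * a)).+1).
    by move=> w0; rewrite -!scaler_nat scalerA !riesz_ler_wZ2r.
  rewrite sandwich // andbT -!gMn.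
  by have /andP[wlo whi] := sandwich _ u u0; rewrite !g_le.
have step m : g u *+ m.+1 - g u *+ m = g u by rewrite mulrS addrK.
(* Antisymmetry replaces the absolute value: every multiple of either difference is at most [g u],
   the length of an interval containing both terms. *)
apply/eqP; rewrite eq_le; apply/andP; split; rewrite -riesz_subr_le0;
  apply: (riesz_archimedean_le0 archF gu0) => n;
  have [m /andP[/andP[lo1 hi1] /andP[lo2 hi2]]] := bounds n;
  by rewrite mulrnBl -[leRHS](step m) riesz_lerB.
Qed.

Lemma positive_additive_scalable : scalable g.
Proof.
move=> a u; wlog a0 : a u / 0 <= a => [gZ|].
  case: (leP 0 a) => [/gZ//|/ltW a0].
  by rewrite -[a]opprK scaleNr gN gZ ?oppr_ge0 // !scaleNr.
have [p [q [p0 q0 ->]]] := riesz_decomposition u.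
by rewrite scalerBr !gD !gN !gZ_pos // scalerBr.
Qed.

End PositiveAdditive.

Section SubstVar.
Variables (R : realType) (E : lmodType R) (k : nat).
Implicit Types (x : {ffun 'I_k -> E}) (i j : 'I_k).

Lemma subst_varC x i j u v : i != j ->
  subst_var (subst_var x i u) j v = subst_var (subst_var x j v) i u.
Proof.
move=> ij; apply/ffunP => l; rewrite !ffunE.
by case: (eqVneq l j) => // ->; rewrite eq_sym (negPf ij).
Qed.

Lemma subst_var_id x i : subst_var x i (x i) = x.
Proof. by apply/ffunP => l; rewrite ffunE; case: eqP => [->|]. Qed.

End SubstVar.

Section PositiveMultiadditive.
Variables (R : realType) (E F : rieszType R) (k : nat).
Variable A : {ffun 'I_k -> E} -> F.
Hypothesis archF : riesz_archimedean F.
Hypothesis A_add : multiadditive A.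
Hypothesis A_ge0 : forall x : {ffun 'I_k -> E}, (forall i, 0 <= x i) -> 0 <= A x.

Lemma multiadditive_subst_varB x i u v :
  A (subst_var x i (u - v)) = A (subst_var x i u) - A (subst_var x i v).
Proof. by apply: (addIr (A (subst_var x i v))); rewrite -A_add !subrK. Qed.

(* Induction on a list s of variables whose sign is unknown. *)
Lemma positive_multiadditive_scalable (x : {ffun 'I_k -> E}) i :
  scalable (fun u : E => A (subst_var x i u)).
Proof.
suff H (s : seq 'I_k) : forall x : {ffun 'I_k -> E},
    (forall j, j \notin s -> j != i -> 0 <= x j) ->
    scalable (fun u : E => A (subst_var x i u)).
  (* With every variable listed, the sign condition is vacuous. *)
  by apply: (H (enum 'I_k)) => j; rewrite mem_enum.
elim: s => [|j s IHs] {}x x_ge0.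
  apply: positive_additive_scalable => // u u0.
  by apply: A_ge0 => j; rewrite ffunE; case: eqVneq => // /x_ge0; apply.
(* The sign of [x i] is irrelevant, since [u] overwrites it. *)
have [ji|ji] := eqVneq j i.
  apply: IHs => l ls li; apply: x_ge0 => //.
  by rewrite in_cons negb_or ls ji li.
have [p [q [p0 q0 xj]]] := riesz_decomposition (x j).
(* Once entry [j] is a positive [w], such as [p] or [q], only the variables in [s] have unknown
   sign. *)
have IH w : 0 <= w -> scalable (fun u : E => A (subst_var (subst_var x j w) i u)).
  move=> w0; apply: IHs => l ls li; rewrite ffunE.
  by case: eqVneq => // lj; apply: x_ge0; rewrite // in_cons negb_or lj.
(* Additivity in variable [j] needs that substitution outermost; the order is restored afterwards to
   apply [IH]. *)
move=> a u /=; rewrite -(subst_var_id x j) xj !(subst_varC _ _ _ ji).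
rewrite !multiadditive_subst_varB scalerBr -!(subst_varC _ _ _ ji).
by rewrite (IH p p0) (IH q q0).
Qed.

Lemma positive_multiadditive_multilinear : multilinear A.
Proof. by move=> x i a u v; rewrite A_add positive_multiadditive_scalable. Qed.

End PositiveMultiadditive.

Theorem proposition2 (R : realType) (E F : rieszType R)
    (hE : riesz_archimedean E) (hF : riesz_archimedean F)
    (P : E -> F) (hP : positive_Qpolynomial P) :
  is_polynomial P.
Proof.
case: hP => [P0|[m [Pc [HPc nz PE]]]]; [by left | right; exists m, Pc; split=> // k].
(* The components and their generating maps stay the same, hence so does the degree. *)
have [A [A_add _ AE A_ge0]] := HPc k; exists A; split=> //.
exact: positive_multiadditive_multilinear.
Qed.
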